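(* (Model A) Let $d\ge 3$ and assume $\mathbb{E}(\xi(0))\neq 0$. Then there exists no shift-covariant random gradient Gibbs measure $\xi\mapsto\mu[\xi]$ with $\mathbb{E}\big|\int\mu[\xi](\mathrm{d}\eta)\,V'(\eta(b))\big|<\infty$ for all bonds $b\in(\mathbb{Z}^d)^*$.
   Context: Model A: $V\in C^2(\mathbb{R})$ is even, with $V(s)\ge As^2-B$ for all $s$ (some $A>0$, $B\in\mathbb{R}$) and $V''(s)\le C_2$ (some $C_2>0$). The disorder $(\xi(x))_{x\in\mathbb{Z}^d}$ is an i.i.d. family of real random variables with finite nonzero second moment, on a probability space with law $\mathbb P$, expectation $\mathbb E$. For finite $\Lambda\subset\mathbb{Z}^d$, $\partial\Lambda=\{x\notin\Lambda:\|x-y\|_1=1\text{ for some }y\in\Lambda\}$; for boundary condition $\psi\in\mathbb{R}^{\mathbb{Z}^d}$, $$H^\psi_\Lambda[\xi](\phi)=\tfrac12\sum_{x,y\in\Lambda,|x-y|=1}V(\phi(x)-\phi(y))+\sum_{x\in\Lambda,y\in\partial\Lambda,|x-y|=1}V(\phi(x)-\psi(y))+\tfrac12\sum_{x\in\Lambda}\xi(x)\phi(x)$$ (sums over ordered nearest-neighbour pairs), and $\nu^\psi_\Lambda[\xi](\mathrm{d}\phi)=\frac1{Z}e^{-H^\psi_\Lambda[\xi](\phi)}\prod_{x\in\Lambda}\mathrm{d}\phi(x)\prod_{x\notin\Lambda}\delta_{\psi(x)}(\mathrm{d}\phi(x))$. $(\mathbb{Z}^d)^*$ is the set of directed nearest-neighbour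 bonds $b=(x_b,y_b)$, $\nabla\phi(b)=\phi(y_b)-\phi(x_b)$, $\chi$ the set of $\eta\in\mathbb{R}^{(\mathbb{Z}^d)^*}$ satisfying $\eta(-b)=-\eta(b)$ and summing to zero around every plaquette (the gradient fields). $C_b(\chi)$: bounded functions continuous in each bond coordinate. $\mu^\rho_\Lambda[\xi]$ ($\rho\in\chi$) is the image of $\nu^\psi_\Lambda[\xi]$ under $\phi\mapsto\nabla\phi$ for any $\psi$ with $\nabla\psi=\rho$. A gradient Gibbs measure is a probability measure $\mu$ on $\chi$ with $\int\mu(\mathrm{d}\rho)\int\mu^\rho_\Lambda[\xi](\mathrm{d}\eta)F(\eta)=\int\mu(\mathrm{d}\eta)F(\eta)$ for all finite $\Lambda$ and $F\in C_b(\chi)$. With $(\tau_v\eta)(b)=\eta(b-v)$ and $(\tau_v\xi)(y)=\xi(y-v)$, a shift-covariant random gradient Gibbs measure is a measurable map $\xi\mapsto\mu[\xi]$ with $\mu[\xi]$ a gradient Gibbs measure for $\mathbb P$-a.e. $\xi$ and $\int\mu[\tau_v\xi](\mathrm{d}\eta)F(\eta)=\int\mu[\xi](\mathrm{d}\eta)F(\tau_v\eta)$ for all $v\in\mathbb{Z}^d$, $F\in C_b(\chi)$. *)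

(* Defs.v *)
From HB Require Import structures.
From mathcomp Require Import all_boot all_order all_algebra.
From mathcomp Require Import finmap.
From mathcomp Require Import all_classical all_reals all_analysis.
From mathcomp Require Import measurable_realfun.

Set Implicit Arguments.
Unset Strict Implicit.
Unset Printing Implicit Defensive.

Import Order.TTheory GRing.Theory Num.Theory.
Import numFieldNormedType.Exports.

Local Open Scope classical_set_scope.
Local Open Scope ring_scope.


Definition site (d : nat) := 'rV[int]_d.

Definition unitv (d : nat) (i : 'I_d) : site d := delta_mx 0 i.

Definition nn (d : nat) (x y : site d) : bool :=
  (\sum_(i < d) absz (x ord0 i - y ord0 i) == 1)%N.

Definition nbrs (d : nat) (x : site d) : seq (site d) :=
  [seq x + unitv i | i <- enum 'I_d] ++ [seq x - unitv i | i <- enum 'I_d].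

(** directed bonds b = (x_b, y_b); only nearest-neighbour pairs are bonds,
    fields on other pairs are required to vanish (see [gradient_fields]) *)
Definition bond (d : nat) := (site d * site d)%type.

Definition grad (d : nat) (R : realType) (phi : site d -> R) : bond d -> R :=
  fun b => if nn b.1 b.2 then phi b.2 - phi b.1 else 0.

Definition gradient_fields (d : nat) (R : realType) : set (bond d -> R) :=
  [set eta | (forall b : bond d, ~~ nn b.1 b.2 -> eta b = 0)
          /\ (forall x y : site d, eta (y, x) = - eta (x, y))
          /\ (forall (x : site d) (i j : 'I_d), i != j ->
                eta (x, x + unitv i) + eta (x + unitv i, x + unitv i + unitv j)
                + eta (x + unitv i + unitv j, x + unitv j)
                + eta (x + unitv j, x) = 0)].

Definition cyl (I : Type) (R : realType) : set (set (I -> R)) :=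
  [set B | exists (i : I) (A : set R), measurable A /\
                                       B = (fun f => f i) @^-1` A].

Definition BF (d : nat) (R : realType) := g_sigma_algebraType (@cyl (bond d) R).
Definition Xi (d : nat) (R : realType) := g_sigma_algebraType (@cyl (site d) R).

Definition iid_coords (d : nat) (R : realType) (P : probability (Xi d R) R) :
  Prop :=
  forall (S : {fset site d}) (A : site d -> set R),
    (forall x, measurable (A x)) ->
    P (\bigcap_(x in [set` S]) [set xi : Xi d R | A x (xi x)]) =
    (\prod_(x <- S) P [set xi : Xi d R | A x (xi (0 : site d)%R)])%E.

Definition upd (T : eqType) (R : Type) (f : T -> R) (x : T) (t : R) : T -> R :=
  fun y => if y == x then t else f y.

(** H^psi_Lambda[xi](phi), where phi is the full configuration (phi = psi
    outside Lambda); sums over ordered nearest-neighbour pairs *)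
Definition hamiltonian (d : nat) (R : realType) (V : R -> R) (xi : site d -> R)
  (L : {fset site d}) (phi : site d -> R) : R :=
  2^-1 * (\sum_(x <- L) \sum_(y <- nbrs x | y \in L) V (phi x - phi y))
  + (\sum_(x <- L) \sum_(y <- nbrs x | y \notin L) V (phi x - phi y))
  + 2^-1 * (\sum_(x <- L) xi x * phi x).

Fixpoint iter_int (d : nat) (R : realType) (s : seq (site d))
  (f : (site d -> R) -> R) (phi : site d -> R) : \bar R :=
  match s with
  | [::] => (f phi)%:E
  | x :: s' => (\int[@lebesgue_measure R]_t iter_int s' f (upd phi x t))%E
  end.

(** some psi with grad psi = rho (any choice gives the same measure) *)
Definition pot (d : nat) (R : realType) (rho : bond d -> R) : site d -> R :=
  @xget (site d -> R) (fun _ => 0) [set psi | grad psi = rho].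

Definition fv_int (d : nat) (R : realType) (V : R -> R) (xi : site d -> R)
  (L : {fset site d}) (rho : bond d -> R) (F : (bond d -> R) -> R) : R :=
  let psi := pot rho in
  fine (iter_int (enum_fset L)
          (fun phi => expR (- hamiltonian V xi L phi) * F (grad phi)) psi)
  / fine (iter_int (enum_fset L)
          (fun phi => expR (- hamiltonian V xi L phi)) psi).

Definition Cb (d : nat) (R : realType) (F : BF d R -> R) : Prop :=
  measurable_fun setT F /\ (exists M : R, forall eta, `|F eta| <= M) /\
  (forall (eta : bond d -> R) (b : bond d),
      continuous (fun t : R => F (upd eta b t))).

Definition is_GGM (d : nat) (R : realType) (V : R -> R) (xi : site d -> R)
  (mu : probability (BF d R) R) : Prop :=
  mu (@gradient_fields d R) = 1%E /\
  forall (L : {fset site d}) (F : BF d R -> R), Cb F ->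
    (\int[mu]_rho (fv_int V xi L rho F)%:E = \int[mu]_eta (F eta)%:E)%E.

Definition shift_eta (d : nat) (R : realType) (v : site d) (eta : bond d -> R)
  : bond d -> R := fun b => eta (b.1 - v, b.2 - v).
Definition shift_xi (d : nat) (R : realType) (v : site d) (xi : site d -> R)
  : site d -> R := fun y => xi (y - v).

Definition is_shift_cov_RGGM (d : nat) (R : realType) (V : R -> R)
  (P : probability (Xi d R) R) (mu : Xi d R -> probability (BF d R) R) : Prop :=
  (forall A : set (BF d R), measurable A ->
      measurable_fun setT (fun xi : Xi d R => mu xi A))
  /\ {ae P, forall xi : Xi d R, is_GGM V xi (mu xi)}
  /\ (forall (v : site d) (F : BF d R -> R) (xi : Xi d R), Cb F ->
        (\int[mu (shift_xi v xi)]_eta (F eta)%:E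
         = \int[mu xi]_eta (F (shift_eta v eta))%:E)%E).

(* Main.v *)
Require Import Defs.
From HB Require Import structures.
From mathcomp Require Import all_boot all_order all_algebra.
From mathcomp Require Import finmap.
From mathcomp Require Import all_classical all_reals all_analysis.
From mathcomp Require Import measurable_realfun ring lra.
Set Implicit Arguments.
Unset Strict Implicit.
Unset Printing Implicit Defensive.
Import Order.TTheory GRing.Theory Num.Theory.
Import numFieldNormedType.Exports.
Local Open Scope classical_set_scope.
Local Open Scope ring_scope.

(** Integrating by parts in the single variable [phi(x)] shows that a gradient
    Gibbs measure gives mean zero to [dH/dphi(x)]: the mean stress
    [m_b = \int mu[xi](d eta) V'(eta b)] is a flow on the bonds whose divergence
    at [x] is [xi(x) / 2] up to sign. Shift covariance and the shift invariance
    of the i.i.d. law make the disorder averages of [m] on parallel bonds equal,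
    so the averaged flow has zero divergence, whence [E(xi(x)) = 0].

    The DLR equation is only available for bounded test functions, so the
    integration by parts is carried out with a compactly supported cutoff of
    the gradients at [x], which is removed by dominated convergence; the
    dominating function is [|dH/dphi(x)|] plus a constant. *)

(** * One-variable calculus: the squared positive part and integration by parts *)

Section Calculus.
Context {R : realType}.
Implicit Types (f g F : R -> R) (x a b l : R).

(** The difference quotient with increment [h] is within [|h|] of [l]. *)
Lemma is_derive_quadratic_error f x l :
  (forall y, `|f y - f x - l * (y - x)| <= (y - x) ^+ 2) -> is_derive x 1 f l.
Proof.
move=> fl.
have H : h^-1 *: (f (h *: (1 : R) + x) - f x) @[h --> (0:R)^'] --> l.
  apply/cvgrPdist_le => e e0; near=> h.
  have h0 : h != 0 by near: h; exact: nbhs_dnbhs_neq.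
  have := fl (h *: (1 : R) + x).
  rewrite /GRing.scale /= mulr1 addrK => H.
  rewrite distrC (_ : _ - l = h^-1 * (f (h + x) - f x - l * h)); last by field.
  rewrite normrM normfV ler_pdivrMl ?normr_gt0// (le_trans H)//.
  rewrite -real_normK ?num_real// expr2 ler_wpM2l// ltW//.
  near: h; apply: dnbhs0_lt => //.
by split; [apply/cvg_ex; exists l|apply: cvg_lim].
Unshelve. all: by end_near. Qed.

(** Squaring smooths the kink of the positive part at [0], which is why the cutoff enters squared.
    In each of the four sign cases of [x] and [y] the error is at most [(y - x) ^+ 2]. *)
Lemma is_derive_sqr_pos x :
  is_derive x 1 (fun u : R => Num.max 0 u ^+ 2) (2 * Num.max 0 x).
Proof.
apply: is_derive_quadratic_error => y; rewrite ler_norml.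
have := sqr_ge0 (y - x).
by case: (leP 0 x) => hx; case: (leP 0 y) => hy; rewrite !expr2 => ?;
  apply/andP; split; nra.
Qed.

Lemma is_derive_bigsum (I : Type) (r : seq I) (f : I -> R -> R) (df : I -> R) x :
  (forall i, is_derive x 1 (f i) (df i)) ->
  is_derive x 1 (fun t => \sum_(i <- r) f i t) (\sum_(i <- r) df i).
Proof.
move=> fdf; elim: r => [|i r IH].
  rewrite big_nil (_ : (fun _ => _) = cst 0)//; first exact: is_derive_cst.
  by apply/funext => t; rewrite big_nil.
rewrite big_cons (_ : (fun _ => _) = f i \+ (fun t => \sum_(i <- r) f i t)).
  exact: is_deriveD.
by apply/funext => t; rewrite big_cons.
Qed.

Lemma continuous_bigsum (I : Type) (r : seq I) (f : I -> R -> R) :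
  (forall i, continuous (f i)) -> continuous (fun t => \sum_(i <- r) f i t).
Proof.
move=> cf; elim: r => [|i r IH] t.
  rewrite (_ : (fun _ => _) = cst 0); first exact: cvg_cst.
  by apply/funext => s; rewrite big_nil.
rewrite (_ : (fun _ => _) = f i \+ (fun t => \sum_(i <- r) f i t)).
  by apply: cvgD; [exact: cf|exact: IH].
by apply/funext => s; rewrite big_cons.
Qed.

Lemma is_derive_continuous f (df : R -> R) :
  (forall x : R, is_derive x 1 f (df x)) -> continuous f.
Proof.
by move=> fdf x; apply/differentiable_continuous/derivable1_diffP; case: (fdf x).
Qed.

Lemma integral_derive_compact_support f F a b : a < b ->
  (forall t : R, is_derive t 1 F (f t)) -> continuous f ->
  (forall t, t \notin `]a, b[ -> F t = 0) ->
  (forall t, t \notin `]a, b[ -> f t = 0) ->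
  (\int[lebesgue_measure]_t (f t)%:E = 0)%E.
Proof.
move=> ab Ff cf F0 f0.
have cF := is_derive_continuous Ff.
have : (\int[lebesgue_measure]_(t in `[a, b]) (f t)%:E = (F b)%:E - (F a)%:E)%E.
  apply: continuous_FTC2 => //.
  - exact: continuous_subspaceT.
  - split; first by move=> t _; case: (Ff t).
      by apply: cvg_at_right_filter; exact: cF.
    by apply: cvg_at_left_filter; exact: cF.
  - by move=> t _; rewrite derive1E; case: (Ff t).
rewrite !F0 ?in_itv/= ?ltxx ?andbF// subee//.
rewrite integral_mkcond => <-; apply: eq_integral => t _.
rewrite patchE; case: ifPn => // tab; rewrite f0//.
by apply: contraNN tab => tab; rewrite inE/=; exact: subset_itv_oo_cc.
Qed.

(* The integrand is the derivative of [- (p^+)^2 exp (- U)]. *)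
Lemma integral_by_parts_cutoff (U u p q : R -> R) a b : a < b ->
  (forall t : R, is_derive t 1 U (u t)) -> continuous u ->
  (forall t : R, is_derive t 1 p (q t)) -> continuous q ->
  (forall t, t \notin `]a, b[ -> p t <= 0) ->
  (\int[lebesgue_measure]_t (expR (- U t) *
     (Num.max 0 (p t) ^+ 2 * u t - 2 * Num.max 0 (p t) * q t))%:E = 0)%E.
Proof.
move=> ab Uu cu pq cq p0.
have cU := is_derive_continuous Uu; have cp := is_derive_continuous pq.
have cmax : continuous (fun t => Num.max 0 (p t)).
  by move=> t; apply: continuous_max; [exact: cvg_cst|exact: cp].
have cexp : continuous (fun t => expR (- U t)).
  move=> t; apply: (@continuous_comp _ _ _ (fun t => - U t) expR).
    by apply: cvgN; exact: cU.
  exact: continuous_expR.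
apply: (@integral_derive_compact_support _
  (fun t => - (Num.max 0 (p t) ^+ 2 * expR (- U t))) a b) => //.
- move=> t.
  have dp : is_derive t 1 (fun t => Num.max 0 (p t) ^+ 2)
      (2 * Num.max 0 (p t) * q t).
    exact: (@is_derive1_comp _ (fun u => Num.max 0 u ^+ 2) p _ _ _
      (is_derive_sqr_pos (p t))).
  have dU : is_derive t 1 (fun t => expR (- U t)) (expR (- U t) * (- u t)).
    apply: (@is_derive1_comp _ expR (fun t => - U t)); exact: is_deriveN.
  have := is_deriveN (is_deriveM dp dU).
  rewrite /GRing.scale/= => H; apply: (is_derive_eq H); ring.
- move=> t; apply: cvgM; first exact: cexp.
  apply: cvgB; apply: cvgM.
  + by rewrite expr2; apply: cvgM; exact: cmax.
  + exact: cu.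
  + by apply: cvgM; [exact: cvg_cst|exact: cmax].
  + exact: cq.
- by move=> t /p0 pt; rewrite max_l// expr0n/= mul0r oppr0.
- by move=> t /p0 pt; rewrite max_l// expr0n/= !(mul0r, mulr0) subrr mulr0.
Qed.

End Calculus.

(** * Shift invariance of the i.i.d. law *)

Section Measurability.
Context {R : realType} {d : nat}.

Lemma measurable_coord_BF (b : bond d) :
  measurable_fun setT (fun eta : BF d R => eta b).
Proof.
move=> _ A mA; rewrite setTI; apply: sub_sigma_algebra.
by exists b, A.
Qed.

Lemma measurable_coord_Xi (x : site d) :
  measurable_fun setT (fun xi : Xi d R => xi x).
Proof.
move=> _ A mA; rewrite setTI; apply: sub_sigma_algebra.
by exists x, A.
Qed.

Lemma measurable_shift_xi (v : site d) :
  measurable_fun setT (@shift_xi d R v : Xi d R -> Xi d R).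
Proof.
apply: (@measurability _ _ (Xi d R) (Xi d R) setT _ (@cyl (site d) R))
  => // _ [_ [x [A [mA ->]]] <-].
by rewrite setTI; apply: sub_sigma_algebra; exists (x - v), A.
Qed.

Variable P : probability (Xi d R) R.
Hypothesis Piid : iid_coords P.

(** The pi-system of events whose probabilities [iid_coords] prescribes. *)
Definition rectangles : set (set (Xi d R)) :=
  [set B | exists (S : {fset site d}) (A : site d -> set R),
     (forall x, measurable (A x)) /\
     B = \bigcap_(x in [set` S]) [set xi : Xi d R | A x (xi x)]].

Lemma rectangles_setI_closed : setI_closed rectangles.
Proof.
move=> _ _ [S [A [mA ->]]] [S' [A' [mA' ->]]].
(* A site constrained by only one of the two rectangles gets [setT] from the other. *)
exists (S `|` S')%fset, (fun x => (if x \in S then A x else setT) `&`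
  (if x \in S' then A' x else setT)); split.
  by move=> x; apply: measurableI; case: ifP.
apply/seteqP; split => xi /=.
  move=> [H H'] x /=; rewrite in_fsetU; split; case: ifPn => // xS.
    exact: H.
  exact: H'.
move=> H; split => x /= xS.
  by have := H x; rewrite /= in_fsetU xS => /(_ isT)[].
by have := H x; rewrite /= in_fsetU xS orbT => /(_ isT)[].
Qed.

Lemma measurable_rectangles : measurable = <<s rectangles >>.
Proof.
apply/seteqP; split; last first.
  apply: smallest_sub; first exact: smallest_sigma_algebra.
  move=> _ [S [A [mA ->]]]; apply: fin_bigcap_measurable => //.
  move=> x _; have := @measurable_coord_Xi x measurableT _ (mA x).
  by rewrite setTI.
apply: smallest_sub; first exact: smallest_sigma_algebra.
move=> _ [x [A [mA ->]]]; apply: sub_sigma_algebra.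
exists [fset x]%fset, (fun=> A); split=> //.
apply/seteqP; split => xi /=; first by move=> ? y /=; rewrite inE => /eqP ->.
by apply; rewrite /= inE.
Qed.

(** A shift translates the index set of a rectangle and keeps the product of the marginals, so [P]
    and its image agree on a generating pi-system, hence everywhere. *)
Lemma iid_shift_invariant (v : site d) (B : set (Xi d R)) : measurable B ->
  P (shift_xi v @^-1` B) = P B.
Proof.
pose Q := pushforward P (shift_xi v : Xi d R -> Xi d R).
have mshift := measurable_shift_xi v.
move=> mB.
pose s : {mfun Xi d R >-> Xi d R} := HB.pack (@shift_xi d R v)
  (@isMeasurableFun.Build _ _ (Xi d R) (Xi d R) _ (measurable_shift_xi v)).
apply: (@measure_unique _ R (Xi d R) rectangles (fun=> setT) _ _ _ _
  (pushforward P s) P) => //.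
- exact: measurable_rectangles.
- exact: rectangles_setI_closed.
- move=> _; exists fset0, (fun=> setT); split=> //.
  by apply/seteqP; split.
- by rewrite bigcup_const.
- move=> _ [S [A [mA ->]]]; set C := \bigcap_(x in _) _.
  change (P (shift_xi v @^-1` C) = P C); rewrite [RHS]Piid// /C.
  (* The shifted disorder at [x] is [xi (x - v)], so a constraint at [x] becomes one at [x - v]. *)
  pose S' := [fset x - v | x in S]%fset.
  rewrite (_ : _ @^-1` _ = \bigcap_(x in [set` S'])
      [set xi : Xi d R | A (x + v) (xi x)]); last first.
    apply/seteqP; split => xi /=.
      by move=> H _ /imfsetP[x /= xS ->]; have := H x xS; rewrite /= subrK.
    move=> H x /= xS; have := H (x - v); rewrite /= subrK; apply.
    by apply/imfsetP; exists x.
  rewrite (Piid S' (fun x => mA (x + v)))// big_imfset/=; last first.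
    by move=> x y _ _; exact: addIr.
  by apply: eq_bigr => x _; rewrite subrK.
- by move=> _; change (P setT < +oo)%E; rewrite probability_setT ltry.
Qed.

Lemma ge0_integral_shift_xi (v : site d) (f : Xi d R -> \bar R) :
  measurable_fun setT f -> (forall xi, (0 <= f xi)%E) ->
  (\int[P]_xi f (shift_xi v xi) = \int[P]_xi f xi)%E.
Proof.
move=> mf f0.
pose s : {mfun Xi d R >-> Xi d R} := HB.pack (@shift_xi d R v)
  (@isMeasurableFun.Build _ _ (Xi d R) (Xi d R) _ (measurable_shift_xi v)).
rewrite -[LHS](@ge0_integral_pushforward _ _ (Xi d R) (Xi d R) R s
  (measurable_shift_xi v) P setT f)//.
by apply: eq_measure_integral => B mB _; exact: iid_shift_invariant.
Qed.

Lemma integral_shift_xi (v : site d) (f : Xi d R -> \bar R) :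
  measurable_fun setT f ->
  (\int[P]_xi f (shift_xi v xi) = \int[P]_xi f xi)%E.
Proof.
move=> mf; rewrite integralE [RHS]integralE.
congr (_ - _)%E.
  rewrite -(ge0_integral_shift_xi v (measurable_funepos mf) (funepos_ge0 f)).
  by apply: eq_integral => xi _; rewrite !funeposE.
rewrite -(ge0_integral_shift_xi v (measurable_funeneg mf) (funeneg_ge0 f)).
by apply: eq_integral => xi _; rewrite !funenegE.
Qed.
End Measurability.

(** * Integrals against the random gradient measure, as functions of the disorder *)

Section Kernel.
Context {R : realType} {d : nat} (mu : Xi d R -> probability (BF d R) R).

Lemma measurable_integral_kernel (f : BF d R -> \bar R) :
  (forall A : set (BF d R), measurable A ->
      measurable_fun setT (fun xi : Xi d R => mu xi A)) ->
  measurable_fun setT f ->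
  measurable_fun setT (fun xi : Xi d R => \int[mu xi]_eta f eta)%E.
Proof.
move=> mmu mf.
under [X in measurable_fun _ X]eq_fun do rewrite integralE.
apply: emeasurable_funB; apply: measurable_fun_integral_kernel => //.
  exact: measurable_funepos.
exact: measurable_funeneg.
Qed.

Lemma Cb_bounded_coord (g : R -> R) (b : bond d) (M : R) :
  continuous g -> (forall s, `|g s| <= M) -> Cb (fun eta : BF d R => g (eta b)).
Proof.
move=> cg gM; split.
  apply: (measurableT_comp (continuous_measurable_fun cg)).
  exact: measurable_coord_BF.
split; first by exists M.
move=> eta b' t.
rewrite /upd; case: eqVneq => _; first exact: cg.
exact: cvg_cst.
Qed.

(* [Cb] only contains bounded functions; monotone convergence along the
   truncations [min (g^+) n] and [min (g^-) n] removes the bound. *)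
Lemma integral_coord_shift (g : R -> R) (b : bond d) (v : site d)
    (xi : Xi d R) : continuous g ->
  (forall F : BF d R -> R, Cb F ->
    \int[mu (shift_xi v xi)]_eta (F eta)%:E
    = \int[mu xi]_eta (F (shift_eta v eta))%:E)%E ->
  (\int[mu (shift_xi v xi)]_eta (g (eta b))%:E
   = \int[mu xi]_eta (g (eta (b.1 - v, b.2 - v)%R))%:E)%E.
Proof.
move=> cg sh.
have nonneg (h : R -> R) : continuous h -> (forall s, 0 <= h s) ->
    (\int[mu (shift_xi v xi)]_eta (h (eta b))%:E
   = \int[mu xi]_eta (h (eta (b.1 - v, b.2 - v)%R))%:E)%E.
  move=> ch h0.
  have cmin n : continuous (fun s => Num.min (h s) n%:R).
    by move=> s; apply: (@continuous_min _ _ h (cst n%:R));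
      [exact: ch|exact: cvg_cst].
  have lim (m : probability (BF d R) R) c :
      (\int[m]_eta (Num.min (h (eta c)) n%:R)%:E @[n --> \oo] -->
       \int[m]_eta (h (eta c))%:E)%E.
    rewrite (_ : (\int[m]_eta (h (eta c))%:E =
      \int[m]_eta lim ((Num.min (h (eta c)) n%:R)%:E @[n --> \oo]))%E).
      apply: cvg_monotone_convergence => //.
      - move=> n; apply/measurable_EFinP.
        apply: (measurableT_comp (continuous_measurable_fun (cmin n))).
        exact: measurable_coord_BF.
      - by move=> n eta _; rewrite lee_fin le_min h0 ler0n.
      - move=> eta _ n k nk; rewrite lee_fin le_min !ge_min lexx/=.
        by rewrite ler_nat nk orbT.
    apply: eq_integral => eta _; apply/esym/cvg_lim => //.
    (* Once [n] exceeds [h (eta c)] the truncation no longer acts. *)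
    apply: cvg_near_cst; near=> n; congr EFin; apply/min_l/ltW.
    by near: n; exact: nbhs_infty_gtr.
  have := lim (mu (shift_xi v xi)) b.
  under eq_fun => n.
    rewrite (sh (fun eta => Num.min (h (eta b)) n%:R)); last first.
      apply: (@Cb_bounded_coord (fun s => Num.min (h s) n%:R) b n%:R) => // s.
      by rewrite ger0_norm ?ge_min ?lexx ?orbT// le_min h0 ler0n.
    over.
  by move/cvg_lim => <-//; apply/cvg_lim => //; exact: lim.
have cpos : continuous (fun s => Num.max (g s) 0).
  by move=> s; apply: (@continuous_max _ _ g (cst 0)); [exact: cg|exact: cvg_cst].
have cneg : continuous (fun s => Num.max (- g s) 0).
  by move=> s; apply: (@continuous_max _ _ (fun s => - g s) (cst 0));
    [apply: cvgN; exact: cg|exact: cvg_cst].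
rewrite integralE [RHS]integralE; congr (_ - _)%E.
  under eq_integral do rewrite funeposE -EFin_max.
  under [RHS]eq_integral do rewrite funeposE -EFin_max.
  by apply: (nonneg _ cpos) => s; rewrite le_max lexx orbT.
under eq_integral do rewrite funenegE -EFinN -EFin_max.
under [RHS]eq_integral do rewrite funenegE -EFinN -EFin_max.
by apply: (nonneg _ cneg) => s; rewrite le_max lexx orbT.
Unshelve. all: by end_near. Qed.
End Kernel.

(** * The energy as a function of a single spin *)

Section Star.
Context {R : realType} {d : nat}.
Implicit Types (x : site d) (j : 'I_d * bool) (eta : bond d -> R).

(* The [2 d] bonds at [x], all oriented along the positive coordinate
   directions: [j.2] tells whether the bond leaves [x]. *)
Definition star_bond x j : bond d :=
  if j.2 then (x, x + unitv j.1) else (x - unitv j.1, x).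

Definition star_site x j : site d :=
  if j.2 then x + unitv j.1 else x - unitv j.1.

(** For [W = V'] this is the interaction part of dH/dphi(x): raising phi(x) lowers the gradient on
    bonds leaving [x] and raises it on bonds entering [x], whence the sign. *)
Definition flux (W : R -> R) x eta : R :=
  \sum_(j : 'I_d * bool) (-1) ^+ j.2 * W (eta (star_bond x j)).

(** It vanishes once the squared gradients at [x] sum to at least [1 / c] (for [c > 0]), and tends
    to [1] pointwise as [c] tends to [0]. *)
Definition cutoff (c : R) x eta : R :=
  Num.max 0 (1 - c * \sum_(j : 'I_d * bool) eta (star_bond x j) ^+ 2).

(* [cutoff ^ 2 * dH/dphi(x) - d(cutoff ^ 2)/dphi(x)] *)
Definition cutoff_drift (W : R -> R) (c h : R) x eta : R :=
  cutoff c x eta ^+ 2 * (flux W x eta + h)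
  + 4 * c * cutoff c x eta * flux id x eta.

Lemma nn_unitv x (i : 'I_d) : nn x (x + unitv i).
Proof.
rewrite /nn (bigD1 i)//= big1 => [|k ki]; rewrite !mxE/= ?eqxx/=.
  by rewrite opprD addrA subrr sub0r.
by rewrite (negbTE ki)/= addr0 subrr.
Qed.

Lemma unitv_neq0 (i : 'I_d) : unitv i != 0.
Proof.
apply/eqP => /matrixP/(_ 0 i); rewrite !mxE !eqxx/=.
by move/eqP; rewrite oner_eq0.
Qed.

Lemma star_site_neq x j : star_site x j != x.
Proof.
rewrite /star_site; case: j.2.
  by rewrite -[X in _ != X]addr0 (inj_eq (addrI x)) unitv_neq0.
by rewrite -[X in _ != X]addr0 (inj_eq (addrI x)) oppr_eq0 unitv_neq0.
Qed.

(** The orientation of a bond only contributes a sign, which the sign in [flux] cancels when [W] is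
    odd. *)
Lemma grad_star x j (psi : site d -> R) (t : R) :
  grad (upd psi x t) (star_bond x j)
  = (-1) ^+ j.2 * (t - psi (star_site x j)).
Proof.
have := star_site_neq x j; rewrite /star_site /star_bond /grad.
case: j => i [] /= /negbTE xi.
  by rewrite nn_unitv /upd eqxx xi expr1 mulN1r opprB.
have := nn_unitv (x - unitv i) i; rewrite subrK => ->.
by rewrite /upd eqxx xi expr0 mul1r.
Qed.

Lemma big_nbrs x (g : site d -> R) :
  \sum_(y <- nbrs x) g y = \sum_(j : 'I_d * bool) g (star_site x j).
Proof.
transitivity (\sum_i g (x + unitv i) + \sum_i g (x - unitv i)).
  by rewrite /nbrs big_cat; congr (_ + _); rewrite big_map big_enum.
rewrite -(pair_bigA _ (fun i b => g (star_site x (i, b))))/=.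
rewrite -big_split/=; apply: eq_bigr => i _.
by rewrite big_bool.
Qed.

Lemma mem_nbrs x y : y \in nbrs x -> y != x.
Proof.
rewrite mem_cat => /orP[] /mapP[i _ ->].
  exact: (star_site_neq x (i, true)).
exact: (star_site_neq x (i, false)).
Qed.

(** No neighbour of [x] lies in the one-site region, so the interior sum is empty and every bond at
    [x] is a boundary bond. *)
Lemma hamiltonian_fset1 (V : R -> R) xi x (psi : site d -> R) (t : R) :
  hamiltonian V xi [fset x]%fset (upd psi x t)
  = \sum_(j : 'I_d * bool) V (t - psi (star_site x j)) + 2^-1 * xi x * t.
Proof.
rewrite /hamiltonian !big_seq_fset1 -mulrA.
rewrite big_seq_cond big1 ?mulr0 ?add0r; last first.
  by move=> y /andP[/mem_nbrs /negbTE]; rewrite inE => ->.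
congr (_ + _); last by rewrite /upd eqxx.
rewrite -[RHS](@big_nbrs x (fun y => V (t - psi y))) big_seq_cond [RHS]big_seq.
apply: eq_big => y; first by rewrite inE; case: (boolP (y \in _)) => // /mem_nbrs.
by move=> /andP[/mem_nbrs /negbTE yx _]; rewrite /upd eqxx yx.
Qed.

Lemma enum_fset_set1 (x : site d) : enum_fset [fset x]%fset = [:: x].
Proof.
apply: perm_small_eq => //; apply: uniq_perm => [|//|y].
  exact: (fset_uniq [fset x]%fset).
by rewrite -[LHS]/(y \in [fset x]%fset) !inE.
Qed.

Variable V : R -> R.
Hypothesis dV : forall s : R, derivable V s 1.
Hypothesis dV' : forall s : R, derivable (derive1 V) s 1.
Hypothesis Veven : forall s : R, V (- s) = V s.

Lemma is_derive_derive1 (s : R) : is_derive s 1 V (derive1 V s).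
Proof. by rewrite derive1E; apply: DeriveDef. Qed.

Lemma continuous_derive1 : continuous (derive1 V).
Proof.
by move=> s; apply/differentiable_continuous/derivable1_diffP.
Qed.

Lemma derive1_odd (s : R) : derive1 V (- s) = - derive1 V s.
Proof.
have H : is_derive s 1 (fun s => V (- s)) (derive1 V (- s) * - 1).
  by apply: (@is_derive1_comp _ V (fun s => - s)); exact: is_derive_derive1.
rewrite (_ : (fun s => V (- s)) = V) in H; last by apply/funext => ?; rewrite Veven.
by rewrite [in RHS]derive1E (@derive_val _ _ _ _ _ _ _ H) mulrN1 opprK.
Qed.

Lemma derive1_sign (b : bool) (s : R) :
  (-1) ^+ b * derive1 V ((-1) ^+ b * s) = derive1 V s.
Proof.
by case: b; rewrite ?(expr0, expr1, mul1r, mulN1r)// derive1_odd opprK.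
Qed.

(** The numerator of [fv_int] integrates, over the spin at [x], the derivative of a compactly
    supported function, so it vanishes for every [rho]. *)
Lemma fv_int_cutoff_drift (xi : site d -> R) x (rho : bond d -> R) (c : R) :
  0 < c -> (0 < d)%N ->
  fv_int V xi [fset x]%fset rho (cutoff_drift (derive1 V) c (2^-1 * xi x) x) = 0.
Proof.
move=> c0 d0; rewrite /fv_int enum_fset_set1/=.
set psi := pot rho; set a := fun j => psi (star_site x j).
set h := 2^-1 * xi x.
(* In terms of the spin [t] at [x]: [U] is the energy, [u] its derivative, [p] the cutoff before
   taking the positive part, [q] the derivative of [p]. *)
pose U t := \sum_(j : 'I_d * bool) V (t - a j) + h * t.
pose u t := \sum_(j : 'I_d * bool) derive1 V (t - a j) + h.
pose p t := 1 - c * \sum_(j : 'I_d * bool) (t - a j) ^+ 2.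
pose q t := - (c * \sum_(j : 'I_d * bool) 2 * (t - a j)).
(* Since [M >= 1] and [c * M = c + 1], a distance of at least [M] between [t] and the single
   neighbour value [a j0] gives [c * (t - a j0) ^+ 2 >= c + 1], which already makes [p t]
   negative. *)
pose M := 1 + c^-1.
pose j0 : 'I_d * bool := (Ordinal d0, true).
have dshift j (t : R) : is_derive t 1 (fun t => t - a j) 1.
  by apply: is_derive_eq; rewrite oppr0 addr0.
rewrite (_ : (\int[_]_t _)%E = 0%E) ?mul0r//.
rewrite -[RHS](@integral_by_parts_cutoff R U u p q (a j0 - M) (a j0 + M)).
- apply: eq_integral => t _; congr EFin.
  rewrite hamiltonian_fset1 -/h /cutoff_drift; congr (_ * _).
  have -> : flux (derive1 V) x (grad (upd psi x t)) + h = u t.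
    by congr (_ + _); apply: eq_bigr => j _; rewrite grad_star derive1_sign.
  have -> : cutoff c x (grad (upd psi x t)) = Num.max 0 (p t).
    congr (Num.max _ (_ - _ * _)); apply: eq_bigr => j _.
    by rewrite grad_star exprMn sqrr_sign mul1r.
  have -> : flux id x (grad (upd psi x t)) = \sum_(j : 'I_d * bool) (t - a j).
    by apply: eq_bigr => j _; rewrite grad_star mulrA -expr2 sqrr_sign mul1r.
  (* The factor [4] in [cutoff_drift] combines a [2] from the squared cutoff with a [2] from the
     squared gradients. *)
  by rewrite /q -mulr_sumr; ring.
- by rewrite ltrD2l gtrN// addr_gt0// invr_gt0.
- move=> t; apply: is_deriveD.
    apply: is_derive_bigsum => j; rewrite -[derive1 V _]mulr1.
    apply: (@is_derive1_comp _ V (fun t => t - a j)) => //.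
    exact: is_derive_derive1.
  by apply: is_derive_eq; rewrite /GRing.scale/= mulr1.
- move=> t; apply: cvgD; last exact: cvg_cst.
  apply: continuous_bigsum => j s.
  apply: (@continuous_comp _ _ _ (fun t => t - a j) (derive1 V)).
    by apply: cvgB; [exact: cvg_id|exact: cvg_cst].
  exact: continuous_derive1.
- move=> t.
  have H : is_derive t 1 (fun t => \sum_(j : 'I_d * bool) (t - a j) ^+ 2)
      (\sum_(j : 'I_d * bool) 2 * (t - a j)).
    apply: is_derive_bigsum => j.
    under eq_fun do rewrite expr2.
    apply: (is_derive_eq (is_deriveM (dshift j t) (dshift j t))).
    by rewrite /GRing.scale/= mulr1 mulr_natl mulr2n.
  have := is_deriveB (is_derive_cst (1 : R) t 1) (is_deriveZ c H) => H'.
  by apply: (is_derive_eq H'); rewrite sub0r.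
- move=> t; apply: cvgN; apply: cvgM; first exact: cvg_cst.
  apply: continuous_bigsum => j s; apply: cvgM; first exact: cvg_cst.
  by apply: cvgB; [exact: cvg_id|exact: cvg_cst].
- move=> t; rewrite in_itv/= negb_and -!leNgt => tM.
  rewrite subr_le0 (bigD1 j0)//=.
  have : 0 <= \sum_(j | j != j0) (t - a j) ^+ 2.
    by apply: sumr_ge0 => j _; exact: sqr_ge0.
  set S := \sum_(j | _) _ => S0; rewrite mulrDr.
  have cM : c * M = c + 1 by rewrite mulrDr mulr1 mulfV ?gt_eqF.
  have M1 : 1 <= M by rewrite lerDl invr_ge0 ltW.
  have : M * 1 <= (t - a j0) ^+ 2.
    rewrite (@le_trans _ _ (M * M))// ?ler_pM2l ?(lt_le_trans ltr01)//.
    rewrite -expr2 -[leRHS]real_normK ?num_real// lerXn2r ?nnegrE//.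
      exact: le_trans M1.
    by rewrite ler_normr; case/orP: tM => ?; apply/orP; [right|left]; lra.
  move: (_ ^+ 2) => r2 Mr; have := mulr_ge0 (ltW c0) S0.
  have : c * (M * 1) <= c * r2 by rewrite ler_pM2l.
  by rewrite mulr1 cM; lra.
Qed.

End Star.

(** * Removing the cutoff: bounds, limits and the balance equation at a site *)

Section Balance.
Context {R : realType} {d : nat}.
Implicit Types (x : site d) (j : 'I_d * bool) (eta : bond d -> R) (W : R -> R).

Lemma cutoff_ge0 (c : R) x eta : 0 <= cutoff c x eta.
Proof. by rewrite le_max lexx. Qed.

Lemma cutoff_le1 (c : R) x eta : 0 <= c -> cutoff c x eta <= 1.
Proof.
move=> c0; rewrite ge_max ler01/= lerBlDr lerDl mulr_ge0//.
by apply: sumr_ge0 => j _; exact: sqr_ge0.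
Qed.

Lemma cutoff_neq0 (c : R) x eta : cutoff c x eta != 0 ->
  c * \sum_(j : 'I_d * bool) eta (star_bond x j) ^+ 2 <= 1.
Proof.
rewrite /cutoff; case: (leP 0 _) => [|_]; last by rewrite eqxx.
by rewrite subr_ge0.
Qed.

Lemma flux_le W x eta (K : R) :
  (forall j, `|W (eta (star_bond x j))| <= K) ->
  `|flux W x eta| <= \sum_(j : 'I_d * bool) K.
Proof.
move=> WK; rewrite (le_trans (ler_norm_sum _ _ _))//.
by apply: ler_sum => j _; rewrite normrM normr_sign mul1r.
Qed.

(** Let [Q] be the sum of the squared gradients at [x]. From [a <= 1 + a ^+ 2] the flux is at most
    [2 d + Q], and [c * Q <= 1] wherever the cutoff is nonzero; the resulting bound [2 d + 1] is
    uniform in [c]. *)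
Lemma cutoff_flux_le (c : R) x eta : 0 <= c <= 1 ->
  `|c * cutoff c x eta * flux id x eta| <= \sum_(j : 'I_d * bool) 1 + 1.
Proof.
move=> /andP[c0 c1].
have S0 : 0 <= \sum_(j : 'I_d * bool) (1 : R) by apply: sumr_ge0.
have [->|/cutoff_neq0 cQ] := eqVneq (cutoff c x eta) 0.
  by rewrite mulr0 mul0r normr0 addr_ge0.
have cut0 := cutoff_ge0 c x eta; have cut1 := cutoff_le1 x eta c0.
have : `|flux id x eta| <= \sum_(j : 'I_d * bool) 1 +
    \sum_(j : 'I_d * bool) eta (star_bond x j) ^+ 2.
  rewrite (le_trans (ler_norm_sum _ _ _))// -big_split/=.
  apply: ler_sum => j _; rewrite normrM normr_sign mul1r.
  rewrite -[X in _ + X]real_normK ?num_real//; set a := `|_|.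
  have := sqr_ge0 (a - 1); have : 0 <= a by exact: normr_ge0.
  nra.
move: cQ S0; set Q := \sum_(j : 'I_d * bool) eta (star_bond x j) ^+ 2.
set S := \sum_(j : 'I_d * bool) 1.
move=> cQ S0 fl.
rewrite !normrM (ger0_norm c0) (ger0_norm cut0) -mulrA.
rewrite (@le_trans _ _ (c * (S + Q)))//.
  rewrite ler_wpM2l// (le_trans _ fl)// ler_piMl//.
by rewrite mulrDr lerD// ler_piMl.
Qed.

(** The right-hand side is independent of [c] and serves as the dominating function when [c] tends
    to [0]. *)
Lemma cutoff_drift_le W (c h : R) x eta : 0 <= c <= 1 ->
  `|cutoff_drift W c h x eta|
  <= `|flux W x eta + h| + 4 * (\sum_(j : 'I_d * bool) 1 + 1).
Proof.
move=> c01; have /andP[c0 c1] := c01.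
have cut0 := cutoff_ge0 c x eta; have cut1 := cutoff_le1 x eta c0.
rewrite (le_trans (ler_normD _ _))// lerD//.
  rewrite normrM ler_piMl// ger0_norm ?sqr_ge0// expr_le1//.
by rewrite -!mulrA normrM ger0_norm// ler_pM2l// mulrA cutoff_flux_le.
Qed.

Lemma continuous_norm_bounded W (M : R) : continuous W -> 0 <= M ->
  exists K, forall s, `|s| <= M -> `|W s| <= K.
Proof.
move=> cW M0; have cn : continuous (fun s => `|W s|).
  by move=> s; apply: cvg_norm; exact: cW.
have [|s _ sM] := @EVT_max R (fun s => `|W s|) (- M) M _
  (continuous_subspaceT cn); first by rewrite ge0_cp.
by exists `|W s| => t tM; apply: sM; rewrite in_itv/= -ler_norml.
Qed.

Lemma measurable_flux W x : continuous W ->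
  measurable_fun setT (flux W x : BF d R -> R).
Proof.
move=> cW; apply: measurable_sum => j; apply: measurable_funM => //.
apply: (measurableT_comp (continuous_measurable_fun cW)).
exact: measurable_coord_BF.
Qed.

Lemma continuous_upd eta (b b' : bond d) : continuous (fun t : R => upd eta b t b').
Proof.
by move=> t; rewrite /upd; case: eqVneq => _; [exact: cvg_id|exact: cvg_cst].
Qed.

Lemma continuous_flux_upd W x eta (b : bond d) : continuous W ->
  continuous (fun t : R => flux W x (upd eta b t)).
Proof.
move=> cW; apply: continuous_bigsum => j t.
apply: cvgM; first exact: cvg_cst.
apply: (@continuous_comp _ _ _ (fun t => upd eta b t (star_bond x j)) W).
  exact: continuous_upd.
exact: cW.
Qed.

(** Boundedness: where the cutoff is nonzero the gradients at [x] stay in a compact interval, on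
    which the continuous [W] is bounded; elsewhere the drift is zero. *)
Lemma Cb_cutoff_drift W (c h : R) x : continuous W -> 0 < c ->
  Cb (cutoff_drift W c h x : BF d R -> R).
Proof.
move=> cW c0.
have cid : continuous (id : R -> R) by move=> t; exact: cvg_id.
split; [|split].
- have mcut : measurable_fun setT (cutoff c x : BF d R -> R).
    apply: measurable_maxr => //; apply: measurable_funB => //.
    apply: measurable_funM => //; apply: measurable_sum => j.
    by apply: measurable_funX; exact: measurable_coord_BF.
  apply: measurable_funD; apply: measurable_funM.
  + exact: measurable_funX.
  + by apply: measurable_funD => //; exact: measurable_flux.
  + exact: measurable_funM.
  + exact: measurable_flux.
(* A bound on [|eta|] without square roots: if [eta ^+ 2 <= c^-1], then
   [|eta| <= 1 + eta ^+ 2 <= M]. *)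
- pose M : R := 1 + c^-1.
  have M0 : 0 <= M by rewrite addr_ge0// invr_ge0 ltW.
  have [K WK] := continuous_norm_bounded cW M0.
  exists (\sum_(j : 'I_d * bool) K + `|h| + 4 * c * \sum_(j : 'I_d * bool) M).
  move=> eta; rewrite /cutoff_drift.
  have [->|cut] := eqVneq (cutoff c x eta) 0.
    rewrite expr0n/= !(mulr0, mul0r) addr0 normr0.
    have K0 : 0 <= K by rewrite (le_trans (normr_ge0 (W 0)))// WK// normr0.
    by rewrite !addr_ge0 ?mulr_ge0 ?sumr_ge0 ?(ltW c0).
  have etaM j : `|eta (star_bond x j)| <= M.
    have : eta (star_bond x j) ^+ 2 <= c^-1.
      rewrite -(ler_pM2l c0) divff ?gt_eqF//.
      rewrite (le_trans _ (cutoff_neq0 cut))// ler_pM2l//.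
      rewrite (bigD1 j)//= lerDl; apply: sumr_ge0 => k _; exact: sqr_ge0.
    rewrite -real_normK ?num_real// /M; set a := `|_|.
    have : 0 <= a by exact: normr_ge0. nra.
  have cut0 := cutoff_ge0 c x eta; have cut1 := cutoff_le1 x eta (ltW c0).
  rewrite (le_trans (ler_normD _ _))// lerD//.
    rewrite normrM ger0_norm ?sqr_ge0//.
    rewrite (@le_trans _ _ `|flux W x eta + h|) ?ler_piMl ?expr_le1//.
    rewrite (le_trans (ler_normD _ _))// lerD2r; apply: flux_le => j.
    exact/WK/etaM.
  rewrite normrM ler_pM//; last by apply: flux_le => j; exact: etaM.
  by rewrite ger0_norm ?ler_piMr// ?mulr_ge0// ltW.
- move=> eta b.
  have ccut : continuous (fun t => cutoff c x (upd eta b t)).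
    move=> t; apply: (@continuous_max _ _ (cst 0)
      (fun t => 1 - c * \sum_(j : 'I_d * bool) upd eta b t (star_bond x j) ^+ 2)).
      exact: cvg_cst.
    apply: cvgB; first exact: cvg_cst.
    apply: cvgM; first exact: cvg_cst.
    apply: continuous_bigsum => j s.
    by apply: cvgM; exact: continuous_upd.
  move=> t; apply: cvgD; apply: cvgM.
  + by rewrite expr2; apply: cvgM; exact: ccut.
  + by apply: cvgD; [exact: continuous_flux_upd|exact: cvg_cst].
  + by apply: cvgM; [exact: cvg_cst|exact: ccut].
  + exact: continuous_flux_upd.
Qed.

(** With [c = 1 / (n + 1)], the cutoff tends to [1] at fixed [eta], while the term from its
    derivative carries a factor [c] and disappears. *)
Lemma cvg_cutoff_drift W (h : R) x eta :
  cutoff_drift W n.+1%:R^-1 h x eta @[n --> \oo] --> flux W x eta + h.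
Proof.
set Q := \sum_(j : 'I_d * bool) eta (star_bond x j) ^+ 2.
have ch : n.+1%:R^-1 @[n --> \oo] --> (0 : R) by exact: cvg_harmonic.
have cut : cutoff n.+1%:R^-1 x eta @[n --> \oo] --> (1 : R).
  have cm : {for (0 : R), continuous (fun c : R => Num.max 0 (1 - c * Q))}.
    apply: (@continuous_max _ _ (cst 0) (fun c : R => 1 - c * Q)).
      exact: cvg_cst.
    apply: cvgB; first exact: cvg_cst.
    by apply: cvgM; [exact: cvg_id|exact: cvg_cst].
  by have := cvg_comp _ _ ch cm; rewrite /= mul0r subr0 max_r//; apply.
rewrite (_ : flux W x eta + h =
  1 * 1 * (flux W x eta + h) + 4 * 0 * 1 * flux id x eta); last by ring.
apply: cvgD; apply: cvgM; try exact: cvg_cst.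
  by under eq_fun do rewrite expr2; exact: cvgM.
by apply: cvgM => //; apply: cvgM => //; exact: cvg_cst.
Qed.

Variable V : R -> R.
Hypothesis dV : forall s : R, derivable V s 1.
Hypothesis dV' : forall s : R, derivable (derive1 V) s 1.
Hypothesis Veven : forall s : R, V (- s) = V s.

(* The equation [\int dH/dphi(x) dmu = 0], whose left-hand side is the
   divergence at [x] of [b |-> \int V'(eta b) dmu] plus [xi x / 2]. *)
Lemma GGM_flux (xi : site d -> R) (mu : probability (BF d R) R) x :
  (0 < d)%N -> is_GGM V xi mu ->
  (forall j,
    mu.-integrable setT (fun eta => (derive1 V (eta (star_bond x j)))%:E)) ->
  (\sum_(j : 'I_d * bool) ((-1) ^+ j.2)%:E *
     \int[mu]_eta (derive1 V (eta (star_bond x j)))%:E = (- (2^-1 * xi x))%:E)%E.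
Proof.
move=> d0 [_ gibbs] int; set h := 2^-1 * xi x; set W := derive1 V.
have cW : continuous W by exact: continuous_derive1.
have intZ j : mu.-integrable setT
    (fun eta => ((-1) ^+ j.2)%:E * (W (eta (star_bond x j)))%:E)%E.
  exact: integrableZl.
under eq_bigr do rewrite -integralZl//.
rewrite -integral_sum//.
have fluxE : (fun eta : BF d R => \sum_(j : 'I_d * bool) ((-1) ^+ j.2)%:E *
    (W (eta (star_bond x j)))%:E)%E = (fun eta => (flux W x eta)%:E).
  by apply/funext => eta; rewrite -sumEFin.
have intflux : mu.-integrable setT (fun eta => (flux W x eta)%:E).
  by rewrite -fluxE; exact: integrable_sum.
rewrite [X in integral _ _ X]fluxE.
have intfluxh : mu.-integrable setT (fun eta => (flux W x eta + h)%:E).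
  have -> : (fun eta : BF d R => (flux W x eta + h)%:E)
      = ((fun eta : BF d R => (flux W x eta)%:E) \+ cst h%:E)%E by exact/funext.
  apply: integrableD => //.
  exact: finite_measure_integrable_cst.
have : (\int[mu]_eta (flux W x eta + h)%:E = 0)%E.
  pose f n eta := (cutoff_drift W n.+1%:R^-1 h x eta)%:E.
  (* The DLR equation for the region consisting of [x] alone. *)
  have f0 n : (\int[mu]_eta f n eta = 0)%E.
    rewrite -(gibbs [fset x]%fset); last by apply: Cb_cutoff_drift.
    by apply: integral0_eq => rho _; rewrite fv_int_cutoff_drift.
  have : (\int[mu]_eta f n eta @[n --> \oo] -->
      \int[mu]_eta (flux W x eta + h)%:E)%E.
    apply: (@dominated_cvg _ _ _ mu setT measurableT f _ (fun eta =>
      (`|flux W x eta + h| + 4 * (\sum_(j : 'I_d * bool) 1 + 1))%:E)).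
    - move=> n; apply/measurable_EFinP.
      by have [] := @Cb_cutoff_drift W n.+1%:R^-1 h x cW _.
    - move=> eta _; apply: cvg_EFin; first exact: nearW.
      exact: cvg_cutoff_drift.
    - by [].
    - have -> : (fun eta : BF d R =>
            (`|flux W x eta + h| + 4 * (\sum_(j : 'I_d * bool) 1 + 1))%:E)
          = ((fun eta : BF d R => `|flux W x eta + h|%:E) \+
             cst (4 * (\sum_(j : 'I_d * bool) 1 + 1))%:E)%E by exact/funext.
      apply: integrableD => //.
        exact: (integrable_abse intfluxh).
      exact: finite_measure_integrable_cst.
    - move=> n eta _; rewrite lee_fin cutoff_drift_le// invr_ge0 ler0n/=.
      by rewrite invf_le1// ler1n.
  under eq_fun do rewrite f0.
  by move/cvg_lim => <-//; rewrite lim_cst.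
under eq_integral do rewrite EFinD.
rewrite integralD//; last exact: finite_measure_integrable_cst.
rewrite integral_cst// (_ : _ * _ = h%:E)%E; last first.
  by have /= -> := probability_setT mu; rewrite mule1.
have := integrable_fin_num measurableT intflux.
case: (integral _ _ _) => // r _; rewrite -EFinD => -[] /eqP.
by rewrite addr_eq0 => /eqP ->.
Qed.
End Balance.

(** * Averaging the balance equation over the disorder *)

(** By convention [+oo - +oo] is [-oo], so a finite integral forces both the positive and the
    negative part to have finite integral. This turns finiteness of the mean stress into
    integrability of [V']. *)
Lemma integral_fin_num_integrable (dsp : measure_display)
    (T : measurableType dsp) (R : realType) (mu : {measure set T -> \bar R})
    (f : T -> \bar R) : measurable_fun setT f ->
  (\int[mu]_t f t \is a fin_num)%E -> mu.-integrable setT f.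
Proof.
move=> mf; rewrite integralE => fin; apply/integrableP; split => //.
rewrite (_ : (fun x => `|f x|%E) = (f^\+ \+ f^\-)%E); last first.
  by rewrite -fune_abse.
rewrite ge0_integralD//; last 2 first.
  exact: measurable_funepos.
  exact: measurable_funeneg.
have : (0 <= \int[mu]_x f^\+ x)%E by exact: integral_ge0.
have : (0 <= \int[mu]_x f^\- x)%E by exact: integral_ge0.
move: fin; case: (\int[mu]_x f^\+ x)%E => [r| |]//;
  case: (\int[mu]_x f^\- x)%E => [s| |]// _ _ _.
by rewrite -EFinD ltry.
Qed.

Lemma shift_cov_mean_disorder0 (d : nat) (R : realType) (V : R -> R)
    (P : probability (Xi d R) R) (mu : Xi d R -> probability (BF d R) R)
    (x : site d) :
  (0 < d)%N ->
  (forall s : R, derivable V s 1) ->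
  (forall s : R, derivable (derive1 V) s 1) ->
  (forall s : R, V (- s) = V s) ->
  iid_coords P ->
  is_shift_cov_RGGM V P mu ->
  (forall b : bond d, nn b.1 b.2 ->
    \int[P]_xi `| \int[mu xi]_eta ((derive1 V) (eta b))%:E | < +oo)%E ->
  (\int[P]_xi (xi x)%:E = 0)%E.
Proof.
move=> d0 dV dV' Veven Piid [mmu [gibbs cov]] fin; set W := derive1 V.
have cW : continuous W by exact: continuous_derive1.
pose m b (xi : Xi d R) := (\int[mu xi]_eta (W (eta b))%:E)%E.
have mW b : measurable_fun setT (fun eta : BF d R => (W (eta b))%:E).
  apply/measurable_EFinP.
  apply: (measurableT_comp (continuous_measurable_fun cW)).
  exact: measurable_coord_BF.
have mm b : measurable_fun setT (m b) by exact: measurable_integral_kernel.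
have nn_star j : nn (star_bond x j).1 (star_bond x j).2.
  case: j => i [] /=; first exact: nn_unitv.
  by have := nn_unitv (x - unitv i) i; rewrite subrK.
have im j : P.-integrable setT (m (star_bond x j)).
  by apply/integrableP; split => //; exact: fin.
(* The bond leaving [x] along axis [i] is the translate by [unitv i] of the one entering [x];
   covariance moves the translation onto the disorder, where [P] absorbs it. *)
have meanE (i : 'I_d) : (\int[P]_xi m (star_bond x (i, true)) xi =
    \int[P]_xi m (star_bond x (i, false)) xi)%E.
  rewrite -(integral_shift_xi Piid (unitv i) (mm _)).
  apply: eq_integral => xi _.
  rewrite /m (@integral_coord_shift _ _ mu W _ (unitv i))//=; last first.
    by move=> F CF; exact: cov.
  by rewrite /star_bond/= addrK.
have balance : {ae P, forall xi, (xi x)%:E = \sum_(j : 'I_d * bool)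
    (- 2 * (-1) ^+ j.2)%:E * m (star_bond x j) xi}%E.
  (* Integrability in the disorder gives finiteness almost everywhere, for the finitely many star
     bonds at once. *)
  have : {ae P, forall xi j, m (star_bond x j) xi \is a fin_num}.
    apply: filter_forall => j.
    by have := integrable_ae measurableT (im j); apply: filterS => xi; apply.
  move: gibbs; apply: filterS2 => xi Gxi finxi.
  have int j : (mu xi).-integrable setT (fun eta => (W (eta (star_bond x j)))%:E).
    exact: (integral_fin_num_integrable (mW _) (finxi j)).
  have := GGM_flux dV dV' Veven d0 Gxi int.
  (* The mean stresses are replaced by real numbers so that the balance equation can be solved for
     [xi x]. *)
  rewrite (eq_bigr (fun j : 'I_d * bool =>
      ((-1) ^+ j.2 * fine (m (star_bond x j) xi))%:E));
    last by move=> j _; rewrite EFinM fineK.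
  rewrite sumEFin => -[sumE].
  rewrite (eq_bigr (fun j : 'I_d * bool =>
      (- 2 * ((-1) ^+ j.2 * fine (m (star_bond x j) xi)))%:E)); last first.
    by move=> j _; rewrite mulrA [RHS]EFinM fineK.
  by rewrite sumEFin -mulr_sumr sumE mulrNN mulrA mulfV ?mul1r// pnatr_eq0.
rewrite (ae_eq_integral (fun xi => \sum_(j : 'I_d * bool)
    (- 2 * (-1) ^+ j.2)%:E * m (star_bond x j) xi)%E)//.
- rewrite integral_sum//; last by move=> j; exact: integrableZl.
  under eq_bigr do rewrite integralZl//.
  (* Grouped by axis, the two bonds have equal finite means and opposite signs, so each pair
     cancels. *)
  rewrite -(pair_bigA _ (fun i b => (- 2 * (-1) ^+ (b : bool))%:E *
    \int[P]_xi m (star_bond x (i, b)) xi)%E)/= big1// => i _.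
  rewrite big_bool/= meanE expr1 expr0 mulrN1 opprK mulr1 EFinN mulNe subee//.
  by rewrite fin_numM//; exact: integrable_fin_num.
- by apply/measurable_EFinP; exact: measurable_coord_Xi.
- by apply: emeasurable_sum => j; exact: measurable_funeM.
- by case: balance => N [mN N0 sN]; exists N; split=> // xi /= H; apply: sN;
    apply: contra_not H => H _.
Qed.

Theorem theorem1p2 (d : nat) (R : realType) (V : R -> R) (A B C2 : R)
  (P : probability (Xi d R) R) :
  (3 <= d)%N ->
  (* V in C^2(R) *)
  (forall s : R, derivable V s 1) ->
  (forall s : R, derivable (derive1 V) s 1) ->
  continuous (derive1 (derive1 V)) ->
  (* V even *)
  (forall s : R, V (- s) = V s) ->
  (* V(s) >= A s^2 - B *)
  0 < A -> (forall s : R, A * s ^+ 2 - B <= V s) ->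
  (* V'' <= C2 *)
  0 < C2 -> (forall s : R, (derive1 (derive1 V)) s <= C2) ->
  (* i.i.d. disorder with finite nonzero second moment *)
  iid_coords P ->
  (\int[P]_xi ((xi 0) ^+ 2)%:E < +oo)%E ->
  (\int[P]_xi ((xi 0) ^+ 2)%:E != 0)%E ->
  (* E(xi(0)) <> 0 *)
  (\int[P]_xi (xi 0)%:E != 0)%E ->
  ~ (exists mu : Xi d R -> probability (BF d R) R,
       is_shift_cov_RGGM V P mu /\
       forall b : bond d, nn b.1 b.2 ->
         (\int[P]_xi `| \int[mu xi]_eta ((derive1 V) (eta b))%:E | < +oo)%E).
Proof.
move=> d3 dV dV' _ Veven _ _ _ _ Piid _ _ /eqP mean [mu [cov fin]]; apply: mean.
have d0 : (0 < d)%N by exact: leq_trans d3.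
exact: (shift_cov_mean_disorder0 0 d0 dV dV' Veven Piid cov fin).
Qed.
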